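(* Let $G$ be a compact metric group. The central measure $\mu_G$ of $G$ is the (normalized, i.e. probability) Haar measure of $G$.
   Context: A metric group is a metrizable topological group equipped with a left-invariant metric inducing the topology of the group. For a nonempty compact metric space $(X,d)$ let $\mathrm{Prob}(X)$ be the set of all Borel probability measures on $X$ with the Kantorovich metric $$\widehat d(\mu,\nu)=\sup\Bigl\{\Bigl|\int_X f\,d\mu-\int_X f\,d\nu\Bigr| : f\colon X\to\mathbb{R},\ |f(x)-f(y)|\le d(x,y)\ \text{for all } x,y\in X\Bigr\}.$$ The space $(\mathrm{Prob}(X),\widehat d)$ is compact and affinely isometric to a convex subset of a normed linear space. For a metric space $(Y,\varrho)$ put $r_Y(x):=\sup_{y\in Y}\varrho(x,y)$ for $x\in Y$, $r(Y):=\inf_{x\in Y}r_Y(x)$, and $C(Y):=\{x\in Y: r_Y(x)=r(Y)\}$ (with the restricted metric). Define $C^0(Y):=Y$, $C^n(Y):=C(C^{n-1}(Y))$ for $n>0$, and $C^{\infty}(Y):=\bigcap_{n=0}^{\infty}C^n(Y)$. If $Y$ is nonempty, compact and isometric to a convex subset of a normed linear space, then $C^{\infty}(Y)$ consists of exactly one point, called the generalized Chebyshev center of $Y$. The central measure $\mu_X$ of a nonempty compact metric space $X$ is the generalized Chebyshev center of $(\mathrm{Prob}(X),\widehat d)$. *)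

(* Defs.v *)
From HB Require Import structures.
From mathcomp Require Import all_boot all_order all_algebra.
From mathcomp Require Import all_classical all_reals all_analysis.
From mathcomp Require Import giry.

Set Implicit Arguments.
Unset Strict Implicit.
Unset Printing Implicit Defensive.

Import Order.TTheory GRing.Theory Num.Theory.
Import numFieldNormedType.Exports.

Local Open Scope classical_set_scope.
Local Open Scope ring_scope.

(* [Pointed] only records nonemptiness: the library attaches sigma-algebras to
   pointed types. The choice of the point plays no role below. *)
#[short(type="pmetricType")]
HB.structure Definition PointedMetric (R : numDomainType) :=
  { X of Pointed X & Metric R X }.

HB.mixin Record isMetricGroup (R : numDomainType) G & Group G & Metric R G := {
  mulg_continuous : continuous (fun p : G * G => (p.1 * p.2)%g) ;
  invg_continuous : continuous (fun x : G => (x^-1)%g) ;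
  mdist_mulgl : forall a x y : G, mdist (a * x)%g (a * y)%g = mdist x y
}.

#[short(type="metricGroupType")]
HB.structure Definition MetricGroup (R : numDomainType) :=
  { G of Group G & PointedMetric R G & isMetricGroup R G }.

Notation borelType X := (g_sigma_algebraType (@open X)).

Notation Prob X R := (probability (borelType X) R).

(* The suprema and the infimum are those of the real numbers; they take the
   junk value 0 on sets that are empty or unbounded, which does not occur for
   nonempty bounded sets [A]. *)
Section chebyshev.
Context {R : realType} {Y : Type} (rho : Y -> Y -> R).
Implicit Types (A : set Y) (x y : Y).

Definition chebyshev_radius_at A x : R := sup [set rho x y | y in A].

Definition chebyshev_radius A : R := inf [set chebyshev_radius_at A x | x in A].

Definition chebyshev_center A : set Y :=
  [set x | A x /\ chebyshev_radius_at A x = chebyshev_radius A].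

Definition chebyshev_centers_infty A : set Y :=
  \bigcap_(n in [set: nat]) iter n chebyshev_center A.

End chebyshev.

Section central_measure.
Context {R : realType} {X : pmetricType R}.

Definition nonexpansive (f : X -> R) : Prop :=
  forall x y, `|f x - f y| <= mdist x y.

Definition kantorovich (mu nu : Prob X R) : R :=
  sup [set `|(\int[mu]_x f x) - (\int[nu]_x f x)| | f in nonexpansive].

(* An element of [Prob X R] is a function on all subsets of [X], subject to
   axioms on the Borel sets only, so two such functions are the same Borel
   measure when they agree on the Borel sets. The condition hence says that
   [mu] is the one and only point of the iterated Chebyshev center. *)
Definition is_central_measure (mu : Prob X R) : Prop :=
  chebyshev_centers_infty kantorovich [set: Prob X R]
  = [set nu : Prob X R | measure_eq nu mu].

End central_measure.

Local Open Scope ereal_scope.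

Definition is_radon {R : realType} {X : pmetricType R}
    (mu : {measure set (borelType X) -> \bar R}) : Prop :=
  [/\ forall K : set X, compact K -> mu K < +oo,
      forall A : set (borelType X), measurable A ->
        mu A = ereal_inf [set mu U | U in [set U : set X | open U /\ A `<=` U]]
    & forall U : set X, open U ->
        mu U =
        ereal_sup [set mu K | K in [set K : set X | compact K /\ K `<=` U]]].

Definition is_haar {R : realType} {G : metricGroupType R}
    (mu : {measure set (borelType G) -> \bar R}) : Prop :=
  [/\ is_radon mu, mu [set: G] != 0
    & forall (g : G) (A : set (borelType G)), measurable A ->
        mu [set (g * x)%g | x in (A : set G)] = mu A].

(* Main.v *)
(** The center of [Prob G] is found without its compactness. Counting the balls
    of radius [e] needed to cover a set is left-invariant, and an ultrafilter
    limit as [e] tends to [0] of normalized counts is additive on separated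
    sets; open covers turn it into a left-invariant Borel probability, whose
    image [rho] by inversion is right-invariant. Every distance to [rho] is
    bounded by the distances to the translates of an arbitrary [mu], since [rho]
    is an average of these translates; as all iterated centers are stable under
    translation, [rho] belongs to each of them. Any other point of their
    intersection would bound all the radii from below and, by convexity, produce
    arbitrarily long separated sequences in the totally bounded space [Prob G].
    So the central measure is [rho], and being unique it is left-invariant. *)

Require Import Defs.
From HB Require Import structures.
From mathcomp Require Import all_boot all_order all_algebra.
From mathcomp Require Import all_classical all_reals all_analysis.
From mathcomp Require Import measurable_realfun giry lra.

Set Implicit Arguments.
Unset Strict Implicit.
Unset Printing Implicit Defensive.

Import Order.TTheory GRing.Theory Num.Theory.
Import numFieldNormedType.Exports.

Local Open Scope classical_set_scope.
Local Open Scope ring_scope.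

(** * Iterated Chebyshev centers *)

Section chebyshev_theory.
Context {R : realType} {Y : Type} (rho : Y -> Y -> R) (D : R).
Hypothesis rhoxx : forall x, rho x x = 0.
Hypothesis rho_sym : forall x y, rho x y = rho y x.
Hypothesis rho_triangle : forall y x z, rho x z <= rho x y + rho y z.
Hypothesis rho_bounded : forall x y, rho x y <= D.
Implicit Types (A : set Y) (x y : Y).

Local Notation radius_at := (chebyshev_radius_at rho).
Local Notation radius := (chebyshev_radius rho).
Local Notation center := (chebyshev_center rho).

Lemma rho_ge0 x y : 0 <= rho x y.
Proof. by have := rho_triangle y x x; rewrite rhoxx (rho_sym y x); lra. Qed.

Lemma has_ubound_rho A x : has_ubound [set rho x y | y in A].
Proof. by exists D => _ [y _ <-]. Qed.

Lemma le_radius_at A x y : A y -> rho x y <= radius_at A x.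
Proof. by move=> Ay; apply: ub_le_sup; [exact: has_ubound_rho|exists y]. Qed.

Lemma radius_at_le A x M :
  A !=set0 -> (forall y, A y -> rho x y <= M) -> radius_at A x <= M.
Proof.
move=> [a Aa] AM; apply: ge_sup; first by exists (rho x a), a.
by move=> _ [y Ay <-]; exact: AM.
Qed.

Lemma radius_le A x : A x -> radius A <= radius_at A x.
Proof.
move=> Ax; apply: ge_inf; last by exists x.
exists 0 => _ [y Ay <-]; exact: le_trans (rho_ge0 y x) (le_radius_at _ _).
Qed.

Lemma mem_center A x :
  A x -> (forall y, A y -> rho x y <= radius A) -> center A x.
Proof.
move=> Ax Axr; split => //; apply/eqP; rewrite eq_le radius_le// andbT.
by apply: radius_at_le => //; exists x.
Qed.

Lemma center_le A x y : center A x -> A y -> rho x y <= radius A.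
Proof. by move=> [_ <-] Ay; exact: le_radius_at. Qed.

Lemma center_far A x M : center A x -> M < radius A ->
  exists2 y, A y & M < rho x y.
Proof.
move=> [Ax <-] /sup_gt Mr; have [|_ [y Ay <-] ?] := Mr; last by exists y.
by exists (rho x x), x.
Qed.

(** [rho] is only a pseudometric here: distinct points may lie at distance zero, as do two functions
    on sets that agree on the Borel sets. Each center must therefore absorb points at distance
    zero. *)
Lemma center_saturated A x y : (forall u v, rho u v = 0 -> A u -> A v) ->
  rho x y = 0 -> center A x -> center A y.
Proof.
move=> satA xy0 cAx; apply: mem_center; first by exact: satA xy0 cAx.1.
move=> z /(center_le cAx); apply: le_trans.
by rewrite (le_trans (rho_triangle x y z))// (rho_sym y) xy0 add0r.
Qed.

Variable mid : Y -> Y -> Y.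
Hypothesis rho_mid : forall x y z, rho (mid x y) z <= (rho x z + rho y z) / 2.

Lemma center_mid A x y : (forall u v, A u -> A v -> A (mid u v)) ->
  center A x -> center A y -> center A (mid x y).
Proof.
move=> midA cAx cAy; apply: mem_center; first exact: midA cAx.1 cAy.1.
move=> z Az; apply: le_trans (rho_mid _ _ _) _.
by have := center_le cAx Az; have := center_le cAy Az; lra.
Qed.

Variables (I : Type) (T : I -> Y -> Y) (Iinv : I -> I).
Hypothesis rho_adj : forall i x y, rho (T i x) y = rho x (T (Iinv i) y).

(** By [rho_adj], moving [x] by [T i] amounts to moving [y] by [T (Iinv i)], which keeps [y] in
    [A]. *)
Lemma center_isometry A i x : (forall j u, A u -> A (T j u)) ->
  center A x -> center A (T i x).
Proof.
move=> TA cAx; apply: mem_center; first exact: TA cAx.1.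
by move=> y Ay; rewrite rho_adj; apply: center_le => //; exact: TA.
Qed.

Variable c : Y.
Hypothesis c_orbit : forall x y M,
  (forall i, rho (T i x) y <= M) -> rho c y <= M.

(** For any [x] in [A], stability of [A] bounds the distances from the whole orbit of [x] to [y] by
    the radius at [x]. The hypothesis on [c] transfers this bound to [c], and [x] is arbitrary. *)
Lemma center_orbit A : (forall j u, A u -> A (T j u)) -> A c -> center A c.
Proof.
move=> TA Ac; apply: mem_center => // y Ay.
apply: lb_le_inf => [|_ [x Ax <-]]; first by exists (radius_at A c), c.
by apply: (c_orbit (x := x)) => i; rewrite rho_adj; apply/le_radius_at/TA.
Qed.

Local Notation C n := (iter n center setT).

Lemma iter_center_saturated n x y : rho x y = 0 -> C n x -> C n y.
Proof. by elim: n x y => //= n IH x y; exact: center_saturated. Qed.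

Lemma iter_center_mid n x y : C n x -> C n y -> C n (mid x y).
Proof. by elim: n x y => //= n IH x y; exact: center_mid. Qed.

Lemma iter_center_isometry n i x : C n x -> C n (T i x).
Proof.
by elim: n i x => //= n IH i x; apply: center_isometry => j u; exact: IH.
Qed.

Lemma iter_center_orbit n : C n c.
Proof.
elim: n => //= n IH; apply: center_orbit => // j u.
exact: iter_center_isometry.
Qed.

Hypothesis rho_totally_bounded : forall e, 0 < e ->
  exists N, forall x : nat -> Y, exists i j, (i < j <= N)%N /\ rho (x i) (x j) < e.

(* If all radii exceed [e], a long [e / 2]-separated sequence is built from the
   deep centers outwards. The point [z] is the iterated midpoint of the points
   chosen so far, and a point of the current center nearly as far as possible
   from [z] is far from all of them, as none of their distances to it can
   exceed the radius. *)
Lemma center_separated_sequence e k n : (forall n, e <= radius (C n)) -> 0 < e ->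
  exists (x : nat -> Y) (z : Y), [/\ C n.+1 z,
    forall i, (i <= k)%N -> C n.+1 (x i),
    forall i j, (i < j <= k)%N -> e / 2 <= rho (x i) (x j) &
    forall i w r, (i <= k)%N -> (forall j, (j <= k)%N -> rho (x j) w <= r) ->
      r - rho (x i) w <= 2 ^+ k * (r - rho z w)].
Proof.
move=> er e0; elim: k n => [|k IH] n.
  exists (fun=> c), c; split => [|i _|i j|i w r _ _].
  - exact: (iter_center_orbit n.+1).
  - exact: (iter_center_orbit n.+1).
  - by rewrite leqn0 => /andP[/[swap] /eqP ->].
  - by rewrite expr0 mul1r.
(* The induction hypothesis is taken one level deeper: [z] and all [x i] are then centers of
   [C n.+1], so every point of [C n.+1] is within its radius of them. *)
have [x [z [Cz Cx xsep xz]]] := IH n.+1.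
have pk : 0 < 2 ^+ k :> R by rewrite exprn_gt0.
(* The last clause multiplies deficits by [2 ^+ k], so the deficit [e / 2 / 2 ^+ k] at [z] becomes
   at most [e / 2] at each [x i]; since the radius is at least [e], a distance of [e / 2]
   remains. *)
have [|y Cy yz] := @center_far (C n.+1) z (radius (C n.+1) - e / 2 / 2 ^+ k) Cz.
  by rewrite ltrBlDr ltrDl !divr_gt0.
have xy i : (i <= k)%N -> e / 2 <= rho (x i) y.
  move=> ik; have xr j : (j <= k)%N -> rho (x j) y <= radius (C n.+1).
    by move=> jk; apply: center_le => //; exact: Cx.
  have := xz i y _ ik xr.
  have : 2 ^+ k * (radius (C n.+1) - rho z y) <= e / 2.
    by rewrite mulrC -ler_pdivlMr//; lra.
  by have := er n.+1; lra.
exists (fun i => if i == k.+1 then y else x i), (mid z y); split.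
- by apply: (@iter_center_mid n.+1) => //; exact: Cz.1.
- move=> i ik; case: eqVneq => // ink; have {}ik : (i <= k)%N.
    by rewrite -ltnS ltn_neqAle ink.
  exact: (Cx i ik).1.
- move=> i j /andP[ij]; rewrite leq_eqVlt => /orP[/eqP jk|jk].
    have ik : (i <= k)%N by rewrite jk in ij.
    by rewrite jk eqxx ltn_eqF//; exact: xy.
  rewrite (ltn_eqF jk) (ltn_eqF (ltn_trans ij jk)).
  by apply: xsep; rewrite ij -ltnS.
- move=> i w r ik xr.
  have xr' j : (j <= k)%N -> rho (x j) w <= r.
    by move=> jk; have := xr j; rewrite leqW// (@ltn_eqF j k.+1)//; exact.
  have yr : rho y w <= r by have := xr k.+1; rewrite eqxx; exact.
  have zr : rho z w <= r.
    rewrite -subr_ge0 -(pmulr_rge0 _ pk); apply: le_trans (xz 0%N w r isT xr').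
    by rewrite subr_ge0; exact: xr'.
  (* The deficits of [z] and [y] are both nonnegative, so each is at most twice that of their
     midpoint. This is where the factor doubles. *)
  have zy : (r - rho z w) + (r - rho y w) <= 2 * (r - rho (mid z y) w).
    by have := rho_mid z y w; lra.
  rewrite exprSr -mulrA.
  case: eqVneq => [_|ink].
    have p1 : 1 <= 2 ^+ k :> R by rewrite exprn_ege1// ler1n.
    rewrite (le_trans _ (ler_peMl _ p1))//; first by lra.
    by apply: le_trans zy; lra.
  have {}ik : (i <= k)%N by rewrite -ltnS ltn_neqAle ink.
  apply: le_trans (xz i w r ik xr') _.
  by rewrite ler_pM2l//; apply: le_trans zy; lra.
Qed.

Lemma chebyshev_centers_infty_orbit :
  chebyshev_centers_infty rho [set: Y] = [set y | rho y c = 0].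
Proof.
apply/seteqP; split => [y Cy|y /= yc n _]; last first.
  by apply: iter_center_saturated (iter_center_orbit n); rewrite rho_sym.
apply/eqP; rewrite eq_le rho_ge0 andbT leNgt; apply/negP => e0.
(* Off by one: [c] is a center of [C n] and [y] belongs to [C n], so their distance is at most the
   radius of [C n]. *)
have er n : rho y c <= radius (C n).
  by rewrite rho_sym; apply: center_le (iter_center_orbit n.+1) (Cy n _).
have [|N Nsep] := @rho_totally_bounded (rho y c / 2); first by rewrite divr_gt0.
have [x [_ [_ _ xsep _]]] := center_separated_sequence N 0 er e0.
by have [i [j [/xsep]]] := Nsep x; rewrite leNgt => /negP.
Qed.

End chebyshev_theory.

(** * Metric outer measures *)

Section metric_outer_measure.
Context {R : realType} {X : metricType R}.
Implicit Types (A B U : set X) (x y : X).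
Local Open Scope ereal_scope.

Definition separated_by (e : R) A B :=
  forall x y, A x -> B y -> (e <= mdist x y)%R.

Let core U n : set X := [set x | ball x n.+1%:R^-1%R `<=` U].

Let core_open U x : open U -> U x -> exists n, core U n x.
Proof.
move=> oU Ux; have /nbhs_ballP[e e0 eU] : nbhs x U by exact: open_nbhs_nbhs.
have [n ne] : exists n, (n.+1%:R^-1 < e)%R.
  exists (Num.trunc e^-1); rewrite -[ltRHS]invrK ltf_pV2 ?posrE ?invr_gt0//.
  exact: truncnS_gt.
by exists n; apply: subset_trans eU; apply: le_ball; exact: ltW.
Qed.

Let core_nondecreasing U m n : (m <= n)%N -> core U m `<=` core U n.
Proof.
move=> mn x; apply: subset_trans; apply: le_ball.
by rewrite lef_pV2 ?posrE// ler_nat.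
Qed.

Let core_separated U n : separated_by n.+1%:R^-1%R (core U n) (~` U).
Proof.
by move=> x y xU yU; rewrite leNgt; apply/negP => xy; apply/yU/xU; rewrite ballEmdist.
Qed.

(** A point outside the next core is within [1 / (n + 2)] of the complement of [U], while [core U n]
    stays at distance [1 / (n + 1)] from it. *)
Let core_separatedS U n : separated_by (n.+1%:R^-1 - n.+2%:R^-1)%R
  (core U n) (~` core U n.+1).
Proof.
move=> x y xU /existsNP[z /not_implyP[yz zU]].
have := core_separated xU zU; have := metric_triangle x y z.
move: yz; rewrite ballEmdist/= => yz xyz xz.
by rewrite lerBlDr (le_trans xz)// (le_trans xyz)// lerD2l ltW.
Qed.

(* The annuli between successive cores of [U] have summable outer measure
   because non-adjacent ones are separated, so that the cores exhaust
   [A `&` U] in outer measure. *)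
Lemma metric_outer_measure_open (mu : {outer_measure set X -> \bar R}) U :
  (forall e A B, (0 < e)%R -> separated_by e A B ->
    mu A + mu B <= mu (A `|` B)) ->
  open U -> mu.-caratheodory U.
Proof.
move=> muU oU; apply: le_caratheodory_measurable => A.
have [->|] := eqVneq (mu A) +oo; first by rewrite leey.
rewrite -ltey => muAoo.
(* [D n] is the part of [A] in an annulus two steps out, so that a full annulus separates it from
   [S n]. *)
pose S n := A `&` core U n; pose D n := S n.+2 `\` S n.+1.
have SA n : mu (S n) <= mu A by apply: le_outer_measure; exact: subIsetl.
have SD n : mu (S n) + mu (D n) <= mu (S n.+2).
  apply: le_trans (le_outer_measure mu _ _ (_ : S n `|` D n `<=` _)).
    apply: (muU (n.+1%:R^-1 - n.+2%:R^-1)%R).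
      by rewrite subr_gt0 ltf_pV2 ?posrE// ltr_nat.
    move=> x y [_ xU] [[Ay _] nSy]; apply: core_separatedS xU _ => yU.
    exact: nSy.
  move=> x [[Ax xU]|[]//]; split => //; apply: core_nondecreasing xU.
  by rewrite -addn2 leq_addr.
(* Adding [D n] turns [S n] into [S n.+2]: the sums over even and odd indices telescope together. *)
have muD n : \sum_(0 <= k < n) mu (D k) <= mu (S n) + mu (S n.+1).
  elim: n => [|n IH]; first by rewrite big_nil adde_ge0 ?outer_measure_ge0.
  rewrite big_nat_recr//= (le_trans (leeD2r _ IH))// addeAC addeC.
  by rewrite leeD2l.
have Doo : \sum_(0 <= k <oo) mu (D k) < +oo.
  apply: (@le_lt_trans _ _ (mu A + mu A)); last by rewrite lte_add_pinfty.
  apply: lime_le.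
    by apply: is_cvg_nneseries => n _ _; exact: outer_measure_ge0.
  by apply: nearW => n; rewrite (le_trans (muD n))// leeD.
apply/lee_addgt0Pr => e e0.
have : \sum_(N <= k <oo) mu (D k) @[N --> \oo] --> 0.
  by apply: nneseries_tail_cvg => // k _; exact: outer_measure_ge0.
move=> /(_ [set x | x < e%:E])[].
  by apply: open_nbhs_nbhs; split; [exact: open_ereal_lt_ereal|rewrite /= lte_fin].
move=> N _ /(_ N (leqnn N))/= Ne.
have AU : mu (A `&` U) <= mu (S N.+1) + e%:E.
  apply: (@le_trans _ _ (mu (S N.+1 `|` \bigcup_(k in ~` `I_N) D k))).
    apply: le_outer_measure => x [Ax Ux]; have [m xm] := core_open oU Ux.
    have [mN|Nm] := leqP m N.+1.
      by left; split => //; exact: core_nondecreasing xm.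
    have [xN|xN] := pselect (core U N.+1 x); first by left.
    (* The least index of a core containing [x] exceeds [N.+1]; two less than this index is the
       index of the annulus containing [x]. *)
    right; have ex_m : exists m, `[< core U m x >] by exists m; exact/asboolP.
    have [k /asboolP xk kmin] := ex_minnP ex_m.
    have Nk : (N.+1 < k)%N.
      by rewrite ltnNge; apply/negP => kN; apply: xN; exact: core_nondecreasing xk.
    case: k xk kmin Nk => [|[|k]]// xk kmin Nk; exists k => /=.
      by apply/negP; rewrite -leqNgt; move: Nk; rewrite !ltnS.
    by split=> // -[_ /asboolP/kmin]; rewrite ltnn.
  rewrite (le_trans (outer_measureU2 _ _ _))// leeD2l//.
  by rewrite (le_trans (outer_measure_sigma_subadditive_tail _ _ _))// ltW.
apply: (le_trans (leeD2r _ AU)); rewrite addeAC leeD2r//.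
apply: (@le_trans _ _ (mu (S N.+1 `|` (A `&` ~` U)))).
  apply: (muU N.+2%:R^-1%R) => [|x y [_ xU] [_ yU]]; first by rewrite invr_gt0.
  exact: core_separated xU yU.
by apply: le_outer_measure => x [[]|[]].
Qed.

End metric_outer_measure.

(** * An invariant content from covering numbers *)

Lemma metric_ball_open {R : realType} (X : metricType R) (x : X) (e : R) :
  open (ball x e).
Proof.
rewrite openE => y; rewrite ballEmdist/= => xy.
apply/nbhs_ballP; exists (e - mdist x y); first by rewrite /= subr_gt0.
move=> z; rewrite !ballEmdist/= ltrBrDl; apply: le_lt_trans.
exact: metric_triangle.
Qed.

Lemma compact_finite_net {R : realType} (X : pmetricType R) (e : R) :
  compact [set: X] -> 0 < e ->
  exists s : seq X, forall x, exists2 y, y \in s & mdist y x < e.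
Proof.
move=> cX e0; move: cX; rewrite compact_cover => /(_ X setT (ball^~ e)).
case=> [x _|x _|s _ sX].
- exact: metric_ball_open.
- by exists x => //; exact: ballxx.
- exists (finmap.enum_fset s) => x; have [y/= ys xy] := sX x I; exists y => //.
  by move: xy; rewrite ballEmdist.
Qed.

Lemma ultra_fmap (T U : Type) (f : T -> U) (F : set_system T) :
  UltraFilter F -> UltraFilter (f @ F).
Proof.
move=> FU; split=> [|H HF sFH]; first exact: fmap_proper_filter.
apply/seteqP; split => // A HA.
have [//|FnA] := in_ultra_setVsetC (f @^-1` A) FU.
by have /filter_ex[? []] : H (A `&` ~` A) by apply: filterI => //; exact: sFH.
Qed.

Section covering_number.
Context {R : realType} {G : metricGroupType R}.
Hypothesis cG : compact [set: G].
Implicit Types (A B : set G) (e : R).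

Definition ball_covers e A : set (seq G) :=
  [set s | forall x, A x -> exists2 y, y \in s & mdist y x < e].

(* The infimum is taken in the reals; it is [0] when there is no cover. *)
Definition covering_number e A : R := inf [set (size s)%:R | s in ball_covers e A].

Lemma has_ball_cover e A : 0 < e -> ball_covers e A !=set0.
Proof. by move=> e0; have [s sG] := compact_finite_net cG e0; exists s => x _. Qed.

Lemma covering_number_le e A s :
  ball_covers e A s -> covering_number e A <= (size s)%:R.
Proof.
by move=> As; apply: ge_inf; [exists 0 => _ [t _ <-]|exists s].
Qed.

Lemma le_covering_number e A M : 0 < e ->
  (forall s, ball_covers e A s -> M <= (size s)%:R) -> M <= covering_number e A.
Proof.
move=> e0 AM; apply: lb_le_inf => [|_ [s As <-]]; last exact: AM.
by have [s As] := has_ball_cover A e0; exists (size s)%:R, s.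
Qed.

Lemma covering_number_ge0 e A : 0 < e -> 0 <= covering_number e A.
Proof. by move=> e0; exact: le_covering_number. Qed.

Lemma covering_number_gt0 e : 0 < e -> 0 < covering_number e [set: G].
Proof.
move=> e0; apply: lt_le_trans (ltr01) _; apply: le_covering_number => // s sG.
by rewrite ler1n lt0n; case: s sG => // /(_ 1%g I)[].
Qed.

Lemma covering_number0 e : 0 < e -> covering_number e set0 = 0.
Proof.
move=> e0; apply/eqP; rewrite eq_le covering_number_ge0// andbT.
by apply: (@covering_number_le e set0 [::]) => x.
Qed.

Lemma subset_covering_number e A B : 0 < e -> A `<=` B ->
  covering_number e A <= covering_number e B.
Proof.
move=> e0 AB; apply: le_covering_number => // s Bs.
by apply: covering_number_le => x /AB; exact: Bs.
Qed.

Lemma covering_numberU e A B : 0 < e ->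
  covering_number e (A `|` B) <= covering_number e A + covering_number e B.
Proof.
move=> e0; rewrite -lerBlDr; apply: le_covering_number => // s As.
rewrite lerBlDl -lerBlDr; apply: le_covering_number => // t Bt.
rewrite lerBlDr -natrD -size_cat; apply: covering_number_le => x.
by move=> [/As[y ys xy]|/Bt[y yt xy]]; exists y => //;
  rewrite mem_cat ?ys ?yt ?orbT.
Qed.

(** A ball of radius [e] cannot meet both sets. In a cover of the union, the centers close to [A]
    cover [A], and the remaining ones cover [B]. *)
Lemma covering_number_separated e d A B : 0 < e -> e <= d / 2 ->
  separated_by d A B ->
  covering_number e A + covering_number e B <= covering_number e (A `|` B).
Proof.
move=> e0 ed AB; apply: le_covering_number => // s ABs.
pose p y := `[< exists2 a, A a & mdist y a < e >].
rewrite -(count_predC p) natrD -!size_filter.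
apply: lerD; apply: covering_number_le => x xAB.
  have [y ys yx] := ABs x (or_introl xAB).
  by exists y => //; rewrite mem_filter ys andbT; apply/asboolP; exists x.
have [y ys yx] := ABs x (or_intror xAB); exists y => //.
rewrite mem_filter ys andbT; apply/negP => /asboolP[a Aa ya].
have := AB a x Aa xAB; have := metric_triangle a y x.
by rewrite (metric_sym a y); lra.
Qed.

Lemma covering_number_mulg e A (g : G) : 0 < e ->
  covering_number e [set (g * x)%g | x in A] <= covering_number e A.
Proof.
move=> e0; apply: le_covering_number => // s As.
rewrite -(size_map (fun x => g * x)%g); apply: covering_number_le.
move=> _ [x /As[y ys yx] <-]; exists (g * y)%g; first exact: map_f.
by rewrite mdist_mulgl.
Qed.

(** The normalized counts lie in [[0, 1]], which is compact, so a single ultrafilter refining the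
    right neighborhoods of [0] gives a limit for every set at once. Nonstrict inequalities pass to
    the limit; superadditivity only needs [e <= d / 2], which holds eventually. *)
Lemma invariant_content_exists : exists h : set G -> R,
  [/\ forall A, 0 <= h A, h set0 = 0, h setT = 1,
      forall A B, A `<=` B -> h A <= h B & [/\
      forall A B, h (A `|` B) <= h A + h B,
      forall d A B, 0 < d -> separated_by d A B -> h A + h B <= h (A `|` B) &
      forall g A, h [set (g * x)%g | x in A] <= h A]].
Proof.
pose N e A := covering_number e A / covering_number e setT.
have [F [FU sF]] := ultraFilterLemma (@at_right_proper_filter R 0).
have Fgt0 : \forall e \near F, 0 < e by apply: sF; exact: nbhs_right_gt.
have Nle e A B : 0 < e -> covering_number e A <= covering_number e B ->
    N e A <= N e B.
  by move=> e0; rewrite ler_pM2r// invr_gt0 covering_number_gt0.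
have Ncvg : forall A : set G, exists l : R, N^~ A @ F --> l.
  move=> A; have := @segment_compact R 0 1; rewrite compact_ultra.
  move=> /(_ _ (ultra_fmap (N^~ A) FU))[|l [_ Nl]]; last by exists l.
  apply: filterS Fgt0 => e e0; rewrite /= in_itv/= divr_ge0 ?covering_number_ge0//=.
  by rewrite ler_pdivrMr ?covering_number_gt0// mul1r subset_covering_number.
have [h Nh] := choice Ncvg.
have h_near A (f : R -> R) l : (\forall e \near F, N e A = f e) ->
    f e @[e --> F] --> l -> h A = l.
  move=> Nf fl; apply: cvg_unique (Nh A) _; first exact: Rhausdorff.
  by apply: cvg_trans fl; apply: near_eq_cvg; apply: filterS Nf => e ->.
have hD A B : N e A + N e B @[e --> F] --> h A + h B by exact: cvgD.
exists h; split.
- move=> A; apply: cvgr_to_ge (Nh A) _; apply: filterS Fgt0 => e e0.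
  by rewrite divr_ge0 ?covering_number_ge0.
- apply: (h_near set0 (cst 0)); last exact: cvg_cst.
  apply: filterS Fgt0 => e e0.
  by rewrite /N covering_number0// mul0r.
- apply: (h_near setT (cst 1)); last exact: cvg_cst.
  apply: filterS Fgt0 => e e0.
  by rewrite /N divff// gt_eqF// covering_number_gt0.
- move=> A B AB; apply: ler_cvg_to (Nh A) (Nh B) _; apply: filterS Fgt0 => e e0.
  by apply: Nle => //; exact: subset_covering_number.
split.
- move=> A B; apply: ler_cvg_to (Nh _) (hD A B) _; apply: filterS Fgt0 => e e0.
  by rewrite -mulrDl ler_pM2r ?invr_gt0 ?covering_number_gt0// covering_numberU.
- move=> d A B d0 AB; apply: ler_cvg_to (hD A B) (Nh _) _.
  have Fd : \forall e \near F, e <= d / 2.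
    by apply: sF; apply: nbhs_right_ltW; rewrite divr_gt0.
  apply: filterS2 Fgt0 Fd => e e0 ed.
  rewrite -mulrDl ler_pM2r ?invr_gt0 ?covering_number_gt0//.
  exact: covering_number_separated ed AB.
- move=> g A; apply: ler_cvg_to (Nh _) (Nh A) _; apply: filterS Fgt0 => e e0.
  by apply: Nle => //; exact: covering_number_mulg.
Qed.

End covering_number.

(** * Haar measure *)

Section translations.
Context {R : realType} {G : metricGroupType R}.
Implicit Types (g : G) (A : set G).

Lemma mulgl_continuous g : continuous (fun x : G => (g * x)%g).
Proof.
move=> x; apply: (@continuous_comp _ _ _ (fun x : G => (g, x)) (fun p => p.1 * p.2)%g).
  by apply: cvg_pair => //; exact: cvg_cst.
exact: mulg_continuous.
Qed.

Lemma mulgr_continuous g : continuous (fun x : G => (x * g)%g).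
Proof.
move=> x; apply: (@continuous_comp _ _ _ (fun x : G => (x, g)) (fun p => p.1 * p.2)%g).
  by apply: cvg_pair => //; exact: cvg_cst.
exact: mulg_continuous.
Qed.

Lemma image_mulgl g A : [set (g * x)%g | x in A] = (fun x => g^-1 * x)%g @^-1` A.
Proof.
apply/seteqP; split => [_ [x Ax <-]|x Ax] /=; first by rewrite mulKg.
by exists (g^-1 * x)%g => //; rewrite mulVKg.
Qed.

Lemma open_image_mulgl g A : open A -> open [set (g * x)%g | x in A].
Proof.
by rewrite image_mulgl; apply: open_comp => x _; exact: mulgl_continuous.
Qed.

End translations.

Section haar_measure.
Context {R : realType} {G : metricGroupType R}.
Hypothesis cG : compact [set: G].
Variable h : set G -> R.
Hypothesis h_ge0 : forall A, 0 <= h A.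
Hypothesis h0 : h set0 = 0.
Hypothesis hT : h setT = 1.
Hypothesis h_le : forall A B, A `<=` B -> h A <= h B.
Hypothesis hU : forall A B, h (A `|` B) <= h A + h B.
Hypothesis h_separated : forall d A B, 0 < d -> separated_by d A B ->
  h A + h B <= h (A `|` B).
Hypothesis h_mulg : forall g A, h [set (g * x)%g | x in A] <= h A.
Implicit Types (A B U : set G).
Local Open Scope ereal_scope.

Let T := borelType G.

(** [mu_ext] takes an infimum over countable covers by Borel sets; the value [+oo] off the open sets
    leaves only open covers with finite cost. *)
Definition open_content (A : set T) : \bar R :=
  if `[< open (A : set G) >] then (h A)%:E else +oo.

Definition haar_outer : set T -> \bar R := mu_ext open_content.

Let open_content_open U : open U -> open_content U = (h U)%:E.
Proof. by move=> oU; rewrite /open_content asboolT. Qed.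

Let open_content0 : open_content set0 = 0.
Proof. by rewrite open_content_open ?h0//; exact: open0. Qed.

Let open_content_ge0 (A : set T) : 0 <= open_content A.
Proof. by rewrite /open_content; case: ifPn; rewrite ?lee_fin ?leey. Qed.

Lemma haar_outer_le A (F : nat -> set G) : (forall k, open (F k)) ->
  A `<=` \bigcup_k F k -> haar_outer A <= \sum_(k <oo) (h (F k))%:E.
Proof.
move=> oF AF; apply: ereal_inf_lbound; exists F.
  by split => // k; exact: sub_sigma_algebra.
by apply: eq_eseriesr => k _; rewrite open_content_open.
Qed.

Lemma haar_outer_approx A M : haar_outer A < M -> exists F : nat -> set G,
  [/\ forall k, open (F k), A `<=` \bigcup_k F k & \sum_(k <oo) (h (F k))%:E < M].
Proof.
move=> /ereal_inf_lt[_ [F [mF AF] <-] FM].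
(* A single member that is not open would make the whole sum infinite. *)
have oF k : open (F k : set G).
  apply: contrapT => noF; move: FM; rewrite (@eseries_pinfty _ _ _ k)//.
  - by rewrite ltNge leey.
  - by move=> n _; rewrite -ltNye (lt_le_trans ltNy0).
  - by rewrite /open_content asboolF.
exists F; split => //; apply: le_lt_trans FM; rewrite le_eqVlt; apply/orP; left.
by apply/eqP/eq_eseriesr => k _; rewrite open_content_open.
Qed.

Lemma le_haar_outer A (M : \bar R) :
  (forall F : nat -> set G, (forall k, open (F k)) -> A `<=` \bigcup_k F k ->
    M <= \sum_(k <oo) (h (F k))%:E) -> M <= haar_outer A.
Proof.
move=> AM; rewrite leNgt; apply/negP => /haar_outer_approx[F [oF AF]].
by rewrite ltNge AM.
Qed.

(** An open cover of the union is cut down to the [e / 3]-neighborhoods of [A] and [B]. These are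
    still [e / 3]-separated, so [h] is superadditive on the two traces of each member of the
    cover. *)
Lemma haar_outer_separated e A B : (0 < e)%R -> separated_by e A B ->
  haar_outer A + haar_outer B <= haar_outer (A `|` B).
Proof.
move=> e0 AB; apply: le_haar_outer => F oF ABF.
have e3 : (0 < e / 3)%R by rewrite divr_gt0.
pose N C := \bigcup_(x in C) ball x (e / 3)%R : set G.
have oN C : open (N C) by apply: bigcup_open => x _; exact: metric_ball_open.
have subN C : C `<=` N C by move=> x Cx; exists x => //; exact: ballxx.
have oFN k C : open (F k `&` N C) by exact: openI.
have FA : haar_outer A <= \sum_(k <oo) (h (F k `&` N A))%:E.
  apply: haar_outer_le => // x Ax; have [|k _ Fx] := ABF x; first by left.
  by exists k => //; split => //; exact: subN.
have FB : haar_outer B <= \sum_(k <oo) (h (F k `&` N B))%:E.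
  apply: haar_outer_le => // x Bx; have [|k _ Fx] := ABF x; first by right.
  by exists k => //; split => //; exact: subN.
apply: le_trans (leeD FA FB) _.
rewrite -nneseriesD; try by move=> k _ _; rewrite lee_fin.
apply: lee_nneseries => [k _ _|k _]; first by rewrite adde_ge0// lee_fin.
rewrite -EFinD lee_fin (le_trans (h_separated e3 _))//; last first.
  by apply: h_le => x [[]|[]].
move=> x y [_ [a Aa ax]] [_ [b Bb yb]].
move: ax yb; rewrite !ballEmdist/= => ax yb.
have := AB a b Aa Bb; have := metric_triangle a x b.
have := metric_triangle x y b; rewrite (metric_sym y b).
by rewrite leNgt => *; apply/negP => *; lra.
Qed.

Let haar_outer0 : haar_outer set0 = 0.
Proof. exact: mu_ext0. Qed.

Let haar_outer_ge0 A : 0 <= haar_outer A.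
Proof. exact: mu_ext_ge0. Qed.

Let haar_outer_subset : {homo haar_outer : A B / A `<=` B >-> A <= B}.
Proof. exact: le_mu_ext. Qed.

Let haar_outer_subadditive : sigma_subadditive haar_outer.
Proof. exact: mu_ext_sigma_subadditive. Qed.

Definition haar_outer_measure : {outer_measure set G -> \bar R} :=
  HB.pack_for {outer_measure set G -> \bar R} (haar_outer : set G -> \bar R)
    (isOuterMeasure.Build R G haar_outer
      haar_outer0 haar_outer_ge0 haar_outer_subset haar_outer_subadditive).

(** The Caratheodory measurable sets form a sigma-algebra, which contains the open sets because the
    outer measure is additive on separated sets. *)
Lemma borel_caratheodory A : (measurable : set (set T)) A ->
  haar_outer_measure.-caratheodory A.
Proof.
move: A; apply: smallest_sub => [|U oU].
  exact: (@sigma_algebra_measurable _ (caratheodory_type haar_outer_measure)).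
apply: metric_outer_measure_open oU; exact: haar_outer_separated.
Qed.

Lemma haar_outer_sigma_additive : semi_sigma_additive haar_outer.
Proof.
move=> F mF tF mUF.
by apply: (@caratheodory_measure_sigma_additive _ _ haar_outer_measure) => //;
  [move=> n|]; exact: borel_caratheodory.
Qed.

HB.instance Definition _ := isMeasure.Build _ T R haar_outer
  haar_outer0 haar_outer_ge0 haar_outer_sigma_additive.

Lemma content_bigsetU (F : nat -> set G) n :
  (h (\big[setU/set0]_(k < n) F k) <= \sum_(k < n) h (F k))%R.
Proof.
elim: n => [|n IH]; first by rewrite !big_ord0 h0.
by rewrite !big_ord_recr/= (le_trans (hU _ _))// lerD2r.
Qed.

Lemma haar_outer_setT : haar_outer setT = 1.
Proof.
apply/eqP; rewrite eq_le; apply/andP; split.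
  apply: le_trans (haar_outer_le (F := fun k => if k is 0%N then setT else set0) _ _) _.
  - by case=> [|k]; [exact: openT|exact: open0].
  - by move=> x _; exists 0%N.
  - rewrite nneseries_recl//; last by move=> *; rewrite lee_fin.
    by rewrite hT eseries_cond/= eseries0 ?adde0// => -[|k]//= _ _; rewrite h0.
(* For the lower bound, compactness reduces a countable open cover to a finite one, where finite
   subadditivity of [h] suffices; [n] exceeds all the indices retained. *)
apply: le_haar_outer => F oF; move: cG; rewrite compact_cover => cG' GF.
have [D _ GD] := cG' nat setT F (fun k _ => oF k) GF.
pose n := (\max_(k <- finmap.enum_fset D) k).+1.
have Gn : setT `<=` \big[setU/set0]_(k < n) F k.
  move=> x /GD[k/= kD Fkx]; rewrite -bigcup_mkord; exists k => //=.
  by rewrite ltnS; exact: leq_bigmax_seq.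
apply: (@le_trans _ _ (\sum_(0 <= k < n) (h (F k))%:E)).
  by rewrite big_mkord sumEFin lee_fin -hT (le_trans (h_le Gn))// content_bigsetU.
by apply: nneseries_lim_ge => k _ _; rewrite lee_fin.
Qed.

HB.instance Definition _ :=
  Measure_isProbability.Build _ T R haar_outer haar_outer_setT.

Lemma haar_outer_mulgl g A : haar_outer [set (g * x)%g | x in A] = haar_outer A.
Proof.
have le_mulg k B : haar_outer [set (k * x)%g | x in B] <= haar_outer B.
  apply: le_haar_outer => F oF BF.
  apply: (@le_trans _ _ (\sum_(i <oo) (h [set (k * x)%g | x in F i])%:E)).
    apply: haar_outer_le => [i|_ [x /BF[i _ Fix] <-]].
      exact: open_image_mulgl.
    by exists i => //; exists x.
  by apply: lee_nneseries => i *; rewrite lee_fin.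
apply/eqP; rewrite eq_le le_mulg/=.
(* The reverse inequality comes from translating back by [g^-1]. *)
rewrite [leLHS](_ : _ = haar_outer [set (g^-1 * x)%g | x in [set (g * x)%g | x in A]]).
  exact: le_mulg.
congr haar_outer; rewrite !image_mulgl.
by apply/seteqP; split => x /=; rewrite invgK mulKg.
Qed.

(** The union of a nearly optimal open cover works, whether or not [A] is Borel. Finiteness of
    [haar_outer A] makes adding [e] a strict increase. *)
Lemma haar_outer_regular A (e : R) : (0 < e)%R ->
  exists U, [/\ open U, A `<=` U & haar_outer U <= haar_outer A + e%:E].
Proof.
move=> e0; have Afin : haar_outer A \is a fin_num.
  rewrite ge0_fin_numE // (le_lt_trans _ (ltry 1%R))//.
  by rewrite -haar_outer_setT; exact: haar_outer_subset.
have [F [oF AF Fe]] : exists F : nat -> set G, [/\ forall k, open (F k),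
    A `<=` \bigcup_k F k & \sum_(k <oo) (h (F k))%:E < haar_outer A + e%:E].
  by apply: haar_outer_approx; rewrite lteDl// lte_fin.
exists (\bigcup_k F k); split => //; first exact: bigcup_open.
by apply: le_trans (ltW Fe); exact: haar_outer_le.
Qed.

Definition haar_probability : Prob G R := haar_outer.

End haar_measure.

(** Outer regularity is recorded along with invariance, as the Radon property of the central measure
    will be derived from it. *)
Lemma left_haar_exists {R : realType} {G : metricGroupType R} :
  compact [set: G] -> exists lam : Prob G R,
  (forall g A, lam [set (g * x)%g | x in A] = lam A) /\
  (forall (A : set G) e, 0 < e ->
    exists U, [/\ open U, A `<=` U & (lam U <= lam A + e%:E)%E]).
Proof.
move=> cG; have [h [h_ge0 h0 hT h_le [hU h_sep h_mulg]]] :=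
  invariant_content_exists cG.
exists (haar_probability cG h_ge0 h0 hT h_le hU h_sep); split.
- exact: haar_outer_mulgl.
- exact: haar_outer_regular.
Qed.

(** * Borel probability measures on a compact metric space *)

Section borel_functions.
Context {R : realType} {X : pmetricType R}.

Lemma open_borel_measurable (U : set X) :
  open U -> (measurable : set (set (borelType X))) U.
Proof. exact: sub_sigma_algebra. Qed.

Lemma closed_borel_measurable (F : set X) :
  closed F -> (measurable : set (set (borelType X))) F.
Proof.
move=> cF; rewrite -(setCK F); apply: measurableC.
by apply: open_borel_measurable; exact: closed_openC.
Qed.

Lemma continuous_borel_measurable (f : X -> R) :
  continuous f -> measurable_fun [set: borelType X] f.
Proof.
move=> cf; apply: (measurability _ (RGenOInfty.measurableE R)) => //.
move=> _ [_ [x ->] <-]; rewrite setTI; apply: open_borel_measurable.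
by apply: open_comp => [y _|]; [exact: cf|rewrite set_itvE; exact: open_gt].
Qed.

Lemma continuous_borel_endo_measurable (f : X -> X) :
  continuous f -> measurable_fun [set: borelType X] (f : borelType X -> borelType X).
Proof.
move=> cf; apply: (@measurability _ _ (borelType X) (borelType X) setT f (@open X)) => //.
move=> _ [U oU <-]; rewrite setTI; apply: open_borel_measurable.
by apply: open_comp => // y _; exact: cf.
Qed.

Lemma nonexpansive_continuous (f : X -> R) : nonexpansive f -> continuous f.
Proof.
move=> nf x; apply/cvgrPdist_lt => e e0; near=> y.
apply: le_lt_trans (nf x y) _; near: y.
have := nbhsx_ballx x e e0; rewrite ballEmdist; exact.
Unshelve. all: by end_near. Qed.

Lemma nonexpansive_cst (c : R) : nonexpansive (fun _ : X => c).
Proof. by move=> x y; rewrite subrr normr0 mdist_ge0. Qed.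

Lemma nonexpansiveN (f : X -> R) : nonexpansive f -> nonexpansive (fun x => - f x).
Proof. by move=> nf x y; rewrite -opprD normrN. Qed.

Lemma nonexpansiveDr (f : X -> R) (c : R) : nonexpansive f -> nonexpansive (fun x => f x + c).
Proof. by move=> nf x y; rewrite opprD addrACA subrr addr0. Qed.

End borel_functions.

Section probability_integral.
Context {R : realType} {X : pmetricType R}.
Hypothesis cX : compact [set: X].
Implicit Types (mu nu : Prob X R) (f : X -> R).

Lemma compact_mdist_bounded : exists2 D : R, 0 < D & forall x y : X, mdist x y <= D.
Proof.
have [s sX] := compact_finite_net cX ltr01.
pose D : R := \sum_(y <- s) mdist (point : X) y.
have D0 : 0 <= D by apply: sumr_ge0 => y _; exact: mdist_ge0.
have xD (x : X) : mdist point x <= D + 1.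
  have [y ys yx] := sX x; rewrite (le_trans (metric_triangle _ y _))//.
  apply: lerD; last exact: ltW.
  by rewrite /D (big_rem y)//= lerDl sumr_ge0// => z _; exact: mdist_ge0.
exists (D + 1 + (D + 1)) => [|x y]; first by lra.
by rewrite (le_trans (metric_triangle _ point _))// lerD// metric_sym.
Qed.

Lemma continuous_integrable mu f :
  continuous f -> mu.-integrable [set: borelType X] (EFin \o f).
Proof.
move=> cf; apply: measurable_bounded_integrable => //.
- by rewrite (le_lt_trans (probability_le1 _ _))// ltry.
- exact: continuous_borel_measurable.
- have /compact_bounded[M [Mr MX]] : compact (f @` setT).
    by apply: continuous_compact cX; exact: continuous_subspaceT.
  by exists M; split => // r Mr' x _; apply: (MX r) => //; exists x.
Qed.

Lemma Rintegral_prob_cst mu (c : R) : \int[mu]_x c = c.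
Proof. by rewrite Rintegral_cst//= [X in fine X]probability_setT mulr1. Qed.

Lemma Rintegral_le mu f (M : R) : continuous f ->
  (forall x, f x <= M) -> \int[mu]_x f x <= M.
Proof.
move=> cf fM; rewrite -[leRHS](Rintegral_prob_cst mu); apply: le_Rintegral => //.
- exact: continuous_integrable.
- by apply: continuous_integrable => x; exact: cvg_cst.
Qed.

Lemma Rintegral_opp mu f : continuous f ->
  \int[mu]_x (- f x) = - \int[mu]_x f x.
Proof.
move=> cf; rewrite -mulN1r -RintegralZl//; last exact: continuous_integrable.
by apply: eq_Rintegral => x _; rewrite mulN1r.
Qed.

Lemma Rintegral_addr mu f c : continuous f ->
  \int[mu]_x (f x + c) = \int[mu]_x f x + c.
Proof.
move=> cf; rewrite RintegralD ?Rintegral_prob_cst//.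
- exact: continuous_integrable.
- by apply: continuous_integrable => x; exact: cvg_cst.
Qed.

Lemma measure_eq_Rintegral mu nu f :
  measure_eq mu nu -> \int[mu]_x f x = \int[nu]_x f x.
Proof. by move=> mn; congr fine; apply: eq_measure_integral => A mA _; exact: mn. Qed.

End probability_integral.

Section pushforward_probability.
Context {R : realType} {X : pmetricType R} (phi : X -> X).
Hypothesis cphi : continuous phi.

Definition borel_mfun : {mfun borelType X >-> borelType X} :=
  HB.pack_for {mfun borelType X >-> borelType X} (phi : borelType X -> borelType X)
    (isMeasurableFun.Build _ _ _ _ (phi : borelType X -> borelType X)
      (continuous_borel_endo_measurable cphi)).

Definition push_probability (mu : Prob X R) : Prob X R := distribution mu borel_mfun.

Lemma push_probabilityE mu (A : set X) : push_probability mu A = mu (phi @^-1` A).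
Proof. by []. Qed.

Lemma Rintegral_push mu (f : X -> R) : compact [set: X] -> continuous f ->
  \int[push_probability mu]_x f x = \int[mu]_x f (phi x).
Proof.
move=> cX cf; congr fine; apply: integral_distribution.
- by apply/measurable_EFinP; exact: continuous_borel_measurable.
- apply: (@continuous_integrable _ _ cX mu (f \o phi)) => x.
  by apply: continuous_comp; [exact: cphi|exact: cf].
Qed.

End pushforward_probability.

Section midpoint.
Context {R : realType} {X : pmetricType R}.
Hypothesis cX : compact [set: X].
Implicit Types mu nu : Prob X R.

Definition half_sum mu nu : set (borelType X) -> \bar R :=
  mscale (2^-1%:nng : {nonneg R}) (measure_add mu nu).

HB.instance Definition _ mu nu := Measure.on (half_sum mu nu).

Let half_sumT mu nu : half_sum mu nu setT = 1%E.
Proof.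
rewrite /half_sum /mscale [X in (_ * X)%E]measure_addE [X in (_ * (X + _))%E]probability_setT.
rewrite [X in (_ * (_ + X))%E]probability_setT -EFinD -EFinM; congr EFin => /=.
lra.
Qed.

HB.instance Definition _ mu nu :=
  Measure_isProbability.Build _ _ _ (half_sum mu nu) (half_sumT mu nu).

Definition midpoint mu nu : Prob X R := half_sum mu nu.

Lemma Rintegral_midpoint mu nu (f : X -> R) : continuous f ->
  \int[midpoint mu nu]_x f x = (\int[mu]_x f x + \int[nu]_x f x) / 2.
Proof.
move=> cf.
(* The formulas for integrals against scaled and added measures are used for nonnegative functions,
   so [f], bounded by compactness, is first shifted by a constant. *)
have [M f0] : exists M, forall x, 0 <= f x + M.
  have /compact_bounded[M [Mr MX]] : compact (f @` setT).
    by apply: continuous_compact cX; exact: continuous_subspaceT.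
  exists (M + 1) => x; have /= := MX (M + 1) _ (f x).
  rewrite ltrDl ltr01 => /(_ isT (ex_intro2 _ _ x I erefl)).
  by rewrite ler_norml => /andP[]; lra.
have cg : continuous (fun x => f x + M).
  by move=> x; apply: cvgD; [exact: cf|exact: cvg_cst].
suff : \int[midpoint mu nu]_x (f x + M) =
    (\int[mu]_x (f x + M) + \int[nu]_x (f x + M)) / 2.
  by rewrite !Rintegral_addr//; lra.
rewrite /Rintegral /midpoint /half_sum.
have mg : measurable_fun [set: borelType X] (fun x => (f x + M)%:E).
  by apply/measurable_EFinP; exact: continuous_borel_measurable.
have g0 (x : X) : [set: X] x -> (0 <= (f x + M)%:E)%E by rewrite lee_fin.
rewrite ge0_integral_mscale// [X in (_ * X)%E]ge0_integral_measure_add//.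
have fin (m : Prob X R) : (\int[m]_x (f x + M)%:E)%E \is a fin_num.
  exact: integrable_fin_num (continuous_integrable cX _ cg).
rewrite -(fineK (fin mu)) -(fineK (fin nu)) -EFinD -EFinM /=.
by rewrite mulrC.
Qed.

End midpoint.

(** * Uniform approximation of integrals by finite sums *)

Section discretization.
Context {R : realType} {X : pmetricType R}.
Hypothesis cX : compact [set: X].
Implicit Types (mu nu : Prob X R) (f : X -> R).

Lemma integrable_Rsum mu (I : Type) (s : seq I) (F : I -> X -> R) :
  (forall i, mu.-integrable [set: borelType X] (EFin \o F i)) ->
  mu.-integrable [set: borelType X] (EFin \o (fun x => \sum_(i <- s) F i x)).
Proof.
move=> intF.
rewrite (_ : EFin \o _ = fun x => \sum_(j <- s) (EFin \o F j) x)%E.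
  by apply: integrable_sum => // j _; exact: intF.
by apply/funext => x /=; rewrite sumEFin.
Qed.

Lemma Rintegral_sum mu (I : Type) (s : seq I) (F : I -> X -> R) :
  (forall i, mu.-integrable [set: borelType X] (EFin \o F i)) ->
  \int[mu]_x (\sum_(i <- s) F i x) = \sum_(i <- s) \int[mu]_x F i x.
Proof.
move=> intF; elim: s => [|i s IH].
  rewrite big_nil -[RHS](Rintegral_prob_cst mu 0).
  by apply: eq_Rintegral => x _; rewrite big_nil.
rewrite big_cons -IH -RintegralD//; last exact: integrable_Rsum.
by apply: eq_Rintegral => x _; rewrite big_cons.
Qed.

Lemma Rintegral_weighted_indic mu (n : nat) (v : 'I_n -> R)
    (B : 'I_n -> set (borelType X)) : (forall i, measurable (B i)) ->
  mu.-integrable [set: borelType X] (EFin \o (fun x => \sum_i v i * \1_(B i) x)) /\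
  \int[mu]_x (\sum_i v i * \1_(B i) x) = \sum_i v i * fine (mu (B i)).
Proof.
move=> mB.
have intB i : mu.-integrable [set: borelType X] (EFin \o \1_(B i)).
  exact: integrable_indic.
have intvB i : mu.-integrable [set: borelType X] (EFin \o (fun x => v i * \1_(B i) x)).
  rewrite (_ : _ \o _ = fun x => (v i)%:E * (EFin \o \1_(B i)) x)%E.
    exact: integrableZl.
  by apply/funext => x /=; rewrite EFinM.
split; last first.
  rewrite Rintegral_sum//; apply: eq_bigr => i _; rewrite RintegralZl//.
  by rewrite /Rintegral integral_indic// setIT.
exact: integrable_Rsum.
Qed.

Lemma measurable_net_partition (e : R) : 0 < e ->
  exists n (a : 'I_n -> X) (B : 'I_n -> set (borelType X)) (k : X -> 'I_n),
  [/\ forall i, measurable (B i), forall i x, B i x <-> k x = i &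
      forall x, mdist (a (k x)) x < e].
Proof.
move=> e0; have [s sX] := compact_finite_net cX e0.
pose p (x y : X) := mdist y x < e; pose c j := nth (point : X) s j.
have lt_find x : (find (p x) s < size s)%N.
  by rewrite -has_find; apply/hasP; have [y] := sX x; exists y.
(* Each point is assigned to the first center of the net within [e] of it, which makes the cells
   disjoint. *)
pose B (i : 'I_(size s)) := ball (c i) e `\` \bigcup_(j in `I_i) ball (c j) e.
exists (size s), c, B, (fun x => Ordinal (lt_find x)); split.
- move=> i; apply: measurableD; apply: open_borel_measurable.
    exact: metric_ball_open.
  by apply: bigcup_open => j _; exact: metric_ball_open.
- move=> i x; rewrite /B !ballEmdist/=; split => [[ix nj]|<-].
    apply/val_inj => /=; case: (ltngtP (find (p x) s) i) => // [fi|ifx].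
      case: nj; exists (find (p x) s) => //; rewrite ballEmdist/=.
      by have /(nth_find point) : has (p x) s by rewrite has_find.
    by have := before_find point ifx; rewrite /p ix.
  split=> [|[j/= jx]].
    by have /(nth_find point) : has (p x) s by rewrite has_find.
  by have := before_find point jx; rewrite ballEmdist/= /p => ->.
- by move=> x /=; have /(nth_find point) : has (p x) s by rewrite has_find.
Qed.

(** The step function equal to [f (a i)] on [B i] is uniformly within [e] of [f]. The cells and
    their base points depend neither on [mu] nor on [f], which is what total boundedness and the
    averaging argument require. *)
Lemma nonexpansive_discretization (e : R) : 0 < e ->
  exists n (a : 'I_n -> X) (B : 'I_n -> set (borelType X)),
  [/\ forall i, measurable (B i), forall mu, \sum_i fine (mu (B i)) = 1 &
      forall mu f, nonexpansive f ->
        `|\int[mu]_x f x - \sum_i f (a i) * fine (mu (B i))| <= e].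
Proof.
move=> e0; have [n [a [B [k [mB Bk ak]]]]] := measurable_net_partition e0.
have sum_indic (v : 'I_n -> R) x : \sum_i v i * \1_(B i) x = v (k x).
  rewrite (bigD1 (k x))//= indicE mem_set ?mulr1; last exact/Bk.
  rewrite big1 ?addr0// => i ik; rewrite indicE memNset ?mulr0// => /Bk kxi.
  by rewrite kxi eqxx in ik.
exists n, a, B; split => // mu.
  have [_] := Rintegral_weighted_indic mu (fun=> 1) mB.
  under eq_bigr do rewrite mul1r; move=> <-.
  by under eq_Rintegral do rewrite sum_indic; rewrite Rintegral_prob_cst.
move=> f nf; have [intS <-] := Rintegral_weighted_indic mu (f \o a) mB.
have cf := nonexpansive_continuous nf.
have inte : mu.-integrable [set: borelType X] (EFin \o (fun=> e)).
  by apply: continuous_integrable => // x; exact: cvg_cst.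
have intf : mu.-integrable [set: borelType X] (EFin \o f).
  exact: continuous_integrable.
set S := fun x => \sum_i _ in intS *.
have fS x : `|f x - S x| <= e.
  by rewrite /S sum_indic (le_trans (nf _ _))// metric_sym ltW.
rewrite ler_distl; apply/andP; split.
- rewrite lerBlDr -[X in _ + X](Rintegral_prob_cst mu) -RintegralD//.
  apply: le_Rintegral => // [|x _].
    exact: (integrableD measurableT intf inte).
  by have := fS x; rewrite ler_distl lerBlDr => /andP[].
- rewrite -[X in _ + X](Rintegral_prob_cst mu) -RintegralD//.
  apply: le_Rintegral => // [|x _].
    exact: (integrableD measurableT intS inte).
  by have := fS x; rewrite ler_distl => /andP[].
Qed.

End discretization.

(** * The Kantorovich metric *)

Section kantorovich_theory.
Context {R : realType} {X : pmetricType R}.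
Hypothesis cX : compact [set: X].
Implicit Types (mu nu : Prob X R) (f : X -> R).

(** A nonexpansive function, hence also its integral, stays within the diameter bound of its value
    at [point]. The supremum defining [kantorovich] is thus a genuine one. *)
Lemma kantorovich_bounded : exists D : R, forall mu nu f, nonexpansive f ->
  `|\int[mu]_x f x - \int[nu]_x f x| <= D.
Proof.
have [D D0 XD] := compact_mdist_bounded cX.
have fD1 mu f : nonexpansive f -> \int[mu]_x f x - f point <= D.
  move=> nf; have cf := nonexpansive_continuous nf.
  rewrite lerBlDr; apply: Rintegral_le => // x.
  by rewrite addrC -lerBlDl (le_trans (ler_norm _))// (le_trans (nf _ _)).
have fD mu f : nonexpansive f -> `|\int[mu]_x f x - f point| <= D.
  move=> nf; rewrite ler_norml fD1// andbT.
  have := fD1 mu _ (nonexpansiveN nf); rewrite Rintegral_opp//; first by lra.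
  exact: nonexpansive_continuous.
exists (D + D) => mu nu f nf.
rewrite (le_trans (ler_distD (f point) _ _))// lerD ?fD// distrC; exact: fD.
Qed.

Lemma le_kantorovich mu nu f : nonexpansive f ->
  `|\int[mu]_x f x - \int[nu]_x f x| <= kantorovich mu nu.
Proof.
move=> nf; have [D XD] := kantorovich_bounded.
by apply: ub_le_sup; [exists D => _ [g ng <-]; exact: XD|exists f].
Qed.

Lemma kantorovich_le mu nu (M : R) : (forall f, nonexpansive f ->
  `|\int[mu]_x f x - \int[nu]_x f x| <= M) -> kantorovich mu nu <= M.
Proof.
move=> XM; apply: ge_sup => [|_ [f nf <-]]; last exact: XM.
by exists `|\int[mu]_x 0 - \int[nu]_x 0|; exists (fun=> 0) => //; exact: nonexpansive_cst.
Qed.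

Lemma kantorovich_le_diff mu nu (M : R) : (forall f, nonexpansive f ->
  \int[mu]_x f x - \int[nu]_x f x <= M) -> kantorovich mu nu <= M.
Proof.
move=> XM; apply: kantorovich_le => f nf; rewrite ler_norml XM// andbT.
have := XM _ (nonexpansiveN nf); have cf := nonexpansive_continuous nf.
by rewrite !Rintegral_opp//; lra.
Qed.

Lemma kantorovichxx mu : kantorovich mu mu = 0.
Proof.
apply/eqP; rewrite eq_le; apply/andP; split.
  by apply: kantorovich_le => f _; rewrite subrr normr0.
by apply: le_trans (le_kantorovich mu mu (nonexpansive_cst 0)).
Qed.

Lemma kantorovich_sym mu nu : kantorovich mu nu = kantorovich nu mu.
Proof.
by apply/eqP; rewrite eq_le; apply/andP; split; apply: kantorovich_le => f nf;
  rewrite distrC le_kantorovich.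
Qed.

Lemma kantorovich_triangle nu mu rho :
  kantorovich mu rho <= kantorovich mu nu + kantorovich nu rho.
Proof.
apply: kantorovich_le => f nf; rewrite (le_trans (ler_distD (\int[nu]_x f x) _ _))//.
by rewrite lerD ?le_kantorovich.
Qed.

Lemma kantorovich_midpoint mu nu rho : kantorovich (midpoint mu nu) rho <=
  (kantorovich mu rho + kantorovich nu rho) / 2.
Proof.
apply: kantorovich_le_diff => f nf.
rewrite Rintegral_midpoint//; last exact: nonexpansive_continuous.
have := le_trans (ler_norm _) (le_kantorovich mu rho nf).
by have := le_trans (ler_norm _) (le_kantorovich nu rho nf); lra.
Qed.

Lemma kantorovich_close (e : R) : 0 < e ->
  exists n (B : 'I_n -> set (borelType X)) (d : R),
  [/\ 0 < d, forall i, measurable (B i) &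
      forall mu nu, (forall i, `|fine (mu (B i)) - fine (nu (B i))| <= d) ->
        kantorovich mu nu < e].
Proof.
move=> e0; have e4 : 0 < e / 4 by rewrite divr_gt0.
have [n [a [B [mB sB aB]]]] := nonexpansive_discretization cX e4.
have [D D0 XD] := compact_mdist_bounded cX.
have nD0 : 0 < n%:R * D + 1 by rewrite ltr_wpDl// mulr_ge0// ltW.
(* Two discretization errors and the difference of the finite sums cost [e / 4] each. The latter has
   [n] terms with coefficients at most [D]; the [+ 1] keeps the denominator positive. *)
exists n, B, (e / 4 / (n%:R * D + 1)); split => // [|mu nu mun].
  by rewrite divr_gt0.
apply: (@le_lt_trans _ _ (e / 4 * 3)); last by lra.
apply: kantorovich_le_diff => f nf.
(* Subtracting [f point] bounds the values of [f] by [D] and leaves the difference of the integrals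
   unchanged, both measures having mass one. *)
have ng := nonexpansiveDr (- f point) nf; have cf := nonexpansive_continuous nf.
have := aB mu _ ng; have := aB nu _ ng.
rewrite !ler_norml !Rintegral_addr// => /andP[nu1 _] /andP[_ mu2].
have : \sum_i (f (a i) - f point) * fine (mu (B i)) -
    \sum_i (f (a i) - f point) * fine (nu (B i)) <= e / 4.
  rewrite -sumrB (@le_trans _ _ (\sum_(i < n) D * (e / 4 / (n%:R * D + 1))))//.
    apply: ler_sum => i _; rewrite -mulrBr (le_trans (ler_norm _))// normrM.
    by rewrite ler_pM// (le_trans (nf _ _)).
  rewrite sumr_const card_ord -[leLHS]mulr_natl.
  rewrite [leLHS](_ : _ = e / 4 * (n%:R * D / (n%:R * D + 1))); last first.
    by rewrite [LHS]mulrA [LHS]mulrCA.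
  apply: ler_piMr; first exact: ltW.
  by rewrite ler_pdivrMr// mul1r lerDl.
by lra.
Qed.

(** Rounding the masses of the finitely many cells gives each measure one of finitely many codes,
    and equal codes force closeness. The pigeonhole principle concludes. *)
Lemma kantorovich_totally_bounded (e : R) : 0 < e ->
  exists N, forall mu : nat -> Prob X R,
    exists i j, (i < j <= N)%N /\ kantorovich (mu i) (mu j) < e.
Proof.
move=> e0; have [n [B [d [d0 mB Bd]]]] := kantorovich_close e0.
(* The rounding step [1 / (m + 1)] is smaller than [d]. A mass in [[0, 1]] rounds to one of [m + 2]
   values, so [inord] never falls back on its default. *)
pose m := Num.truncn d^-1.
pose code (mu : Prob X R) : {ffun 'I_n -> 'I_m.+2} :=
  [ffun i => inord (Num.truncn (m.+1%:R * fine (mu (B i))))].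
have codeP mu nu : code mu = code nu -> kantorovich mu nu < e.
  move=> /ffunP cmn; apply: Bd => i; have := cmn i; rewrite !ffunE => /(congr1 val)/=.
  have mu1 (k : Prob X R) : 0 <= fine (k (B i)) <= 1.
    rewrite fine_ge0//= -lee_fin fineK ?probability_le1//.
    exact: fin_num_measure.
  have trunc_le (k : Prob X R) : (Num.truncn (m.+1%:R * fine (k (B i))) < m.+2)%N.
    have /andP[k0 k1] := mu1 k.
    rewrite ltnS truncn_le_nat (@le_lt_trans _ _ m.+1%:R) ?ltr_nat//.
    exact: ler_piMr.
  have m1d : 1 < m.+1%:R * d.
    by rewrite -ltr_pdivrMr// mul1r; exact: truncnS_gt.
  rewrite !inordK// => mn.
  have /truncn_itv : 0 <= m.+1%:R * fine (mu (B i)).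
    by rewrite mulr_ge0//; have /andP[] := mu1 mu.
  have /truncn_itv : 0 <= m.+1%:R * fine (nu (B i)).
    by rewrite mulr_ge0//; have /andP[] := mu1 nu.
  rewrite -mn; move: (Num.truncn _) => t.
  have -> : t.+1%:R = t%:R + 1 :> R by rewrite natr1.
  move=> /andP[nu1 nu2] /andP[mu2 mu3].
  rewrite -(ler_pM2l (_ : 0 < m.+1%:R))// -[X in X * `|_|]ger0_norm// -normrM mulrBr.
  by apply: ltW; apply: le_lt_trans m1d; rewrite ler_distl; apply/andP; split; lra.
exists #|{ffun 'I_n -> 'I_m.+2}| => mu.
pose g (i : 'I_(#|{ffun 'I_n -> 'I_m.+2}|.+1)) := code (mu i).
have /injectivePn : ~~ injectiveb g.
  by apply/injectiveP => /leq_card; rewrite card_ord ltnn.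
move=> [i [j ij gij]].
wlog ltij : i j ij gij / (i < j)%N.
  move=> H; case: (ltngtP i j) => [lij|lji|/val_inj eij].
  - exact: (H i j).
  - by apply: (H j i) => //; rewrite eq_sym.
  - by rewrite eij eqxx in ij.
by exists i, j; rewrite ltij -ltnS ltn_ord; split => //; exact: codeP.
Qed.

End kantorovich_theory.

(** * Separation of Borel measures by the Kantorovich distance *)

Section open_exhaustion.
Context {R : realType} {X : pmetricType R}.
Implicit Types U : set X.

(** The infimum over an empty complement is the default [0]; hence the point [z0] outside [U] in
    several lemmas, and the separate case of the whole space in [open_exhaustion]. *)
Definition dist_to_compl U (x : X) : R := inf [set mdist x y | y in ~` U].

Lemma dist_to_compl_le U x y : ~ U y -> dist_to_compl U x <= mdist x y.
Proof.
by move=> Uy; apply: ge_inf; [exists 0 => _ [z _ <-]; exact: mdist_ge0|exists y].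
Qed.

Lemma le_dist_to_compl U x z0 (M : R) : ~ U z0 ->
  (forall y, ~ U y -> M <= mdist x y) -> M <= dist_to_compl U x.
Proof.
by move=> Uz0 UM; apply: lb_le_inf => [|_ [y Uy <-]];
  [exists (mdist x z0), z0|exact: UM].
Qed.

Lemma dist_to_compl_nonexpansive U z0 : ~ U z0 -> nonexpansive (dist_to_compl U).
Proof.
move=> Uz0; have le1 x y : dist_to_compl U x - dist_to_compl U y <= mdist x y.
  rewrite lerBlDl -lerBlDr; apply: le_dist_to_compl Uz0 _ => z Uz.
  rewrite lerBlDr (le_trans (dist_to_compl_le x Uz))// addrC.
  exact: metric_triangle.
by move=> x y; rewrite ler_norml le1 andbT lerNl opprB metric_sym.
Qed.

Lemma nonexpansive_min (f : X -> R) (c : R) :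
  nonexpansive f -> nonexpansive (fun x => Num.min (f x) c).
Proof.
move=> nf x y; apply: le_trans (nf x y).
by rewrite !minEle; case: (leP (f x) c) => fx; case: (leP (f y) c) => fy;
  rewrite ?subrr ?normr0// !ler_norml; apply/andP; split;
  have := ler_norm (f x - f y); have := ler_norm (- (f x - f y));
  rewrite normrN; lra.
Qed.

(** The closed sets are superlevel sets of the distance to the complement. Truncating this distance
    at [1 / (n + 1)] and rescaling interpolates between the two indicators; the factor [c n] is kept
    apart so that [f n] itself is nonexpansive. *)
Lemma open_exhaustion U : open U -> exists (K : nat -> set X) (f : nat -> X -> R) (c : nat -> R),
  [/\ forall n, closed (K n), forall m n, (m <= n)%N -> K m `<=` K n,
      \bigcup_n K n = U, forall n, nonexpansive (f n) &
      forall n x, \1_(K n) x <= c n * f n x <= \1_U x].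
Proof.
move=> oU; have [UT|/existsNP[z0 Uz0]] := pselect (forall x, U x).
  have {}UT : U = setT by apply/seteqP; split.
  exists (fun=> setT), (fun _ _ => 1), (fun=> 1); split.
  - by move=> _; exact: closedT.
  - by [].
  - by rewrite UT; apply/seteqP; split => // x _; exists 0%N.
  - by move=> _; exact: nonexpansive_cst.
  - by move=> n x; rewrite UT mulr1 !indicE in_setT lexx.
pose phi := dist_to_compl U; have nphi := dist_to_compl_nonexpansive Uz0.
have phi_ge0 x : 0 <= phi x.
  by apply: le_dist_to_compl Uz0 _ => y _; exact: mdist_ge0.
have phi0 x : ~ U x -> phi x = 0.
  move=> Ux; apply/eqP; rewrite eq_le phi_ge0 andbT -(mdistxx x).
  exact: dist_to_compl_le.
exists (fun n => [set x | n.+1%:R^-1 <= phi x]),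
  (fun n x => Num.min (phi x) n.+1%:R^-1), (fun n => n.+1%:R); split.
- move=> n; rewrite (_ : mkset _ = phi @^-1` [set r | n.+1%:R^-1 <= r])//.
  apply: closed_comp; last exact: closed_ge.
  by move=> x _; exact: nonexpansive_continuous.
- move=> m n mn x /=; apply: le_trans; by rewrite lef_pV2 ?posrE// ler_nat.
- apply/seteqP; split => [x [n _ /= nx]|x Ux].
    apply: contrapT => /phi0 px; move: nx; rewrite px.
    by apply/negP; rewrite -ltNge invr_gt0.
  have /nbhs_ballP[e /= e0 eU] : nbhs x U by exact: open_nbhs_nbhs.
  exists (Num.truncn e^-1) => //=; apply: (@le_trans _ _ e).
    rewrite -[leRHS]invrK lef_pV2 ?posrE ?invr_gt0//; apply: ltW.
    exact: truncnS_gt.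
  apply: le_dist_to_compl Uz0 _ => y Uy; rewrite leNgt; apply/negP => xy.
  by apply/Uy/eU; rewrite ballEmdist.
- by move=> n; exact: nonexpansive_min.
- move=> n x; have n0 : 0 < n.+1%:R :> R by [].
  rewrite -!(ler_pdivrMl _ _ n0) -(ler_pdivlMl _ _ n0) !indicE.
  have n1 : 0 <= n.+1%:R^-1 :> R by rewrite invr_ge0.
  apply/andP; split.
    have [xn|xn] := pselect (n.+1%:R^-1 <= phi x).
      by rewrite mem_set// mulr1 le_min xn lexx.
    by rewrite memNset// mulr0 le_min phi_ge0.
  have [Ux|Ux] := pselect (U x).
    by rewrite mem_set// mulr1 ge_min lexx orbT.
  by rewrite memNset// mulr0 ge_min phi0// lexx.
Qed.

End open_exhaustion.

Section kantorovich_separation.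
Context {R : realType} {X : pmetricType R}.
Hypothesis cX : compact [set: X].
Implicit Types (mu nu : Prob X R) (U : set X).

(** At distance zero both measures integrate every [f n] alike, so [mu (K n)] is at most [nu U];
    continuity from below then exhausts [U]. *)
Lemma kantorovich0_open_le mu nu U : kantorovich mu nu = 0 -> open U ->
  (mu U <= nu U)%E.
Proof.
move=> mn oU; have [K [f [c [clK ndK KU nf Kf]]]] := open_exhaustion oU.
have mK n : (measurable : set (set (borelType X))) (K n).
  exact: closed_borel_measurable.
have mU : (measurable : set (set (borelType X))) U by exact: open_borel_measurable.
have int1 (m : Prob X R) (A : set (borelType X)) : measurable A ->
    \int[m]_x \1_A x = fine (m A).
  by move=> mA; rewrite /Rintegral integral_indic// setIT.
have fin (m : Prob X R) (A : set (borelType X)) : measurable A -> m A \is a fin_num.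
  by move=> mA; exact: fin_num_measure.
have intf (m : Prob X R) n : m.-integrable [set: borelType X] (EFin \o f n).
  by apply: continuous_integrable => //; exact: nonexpansive_continuous.
have intcf (m : Prob X R) n :
    m.-integrable [set: borelType X] (EFin \o (fun x => c n * f n x)).
  apply: continuous_integrable => // x; apply: cvgM; first exact: cvg_cst.
  exact: nonexpansive_continuous.
have KnU n : (mu (K n) <= nu U)%E.
  rewrite -(fineK (fin mu _ (mK n))) -(fineK (fin nu _ mU)) lee_fin.
  rewrite -!int1//; apply: (@le_trans _ _ (\int[mu]_x (c n * f n x))).
    apply: le_Rintegral => //; [exact: integrable_indic|exact: intcf|].
    by move=> x _; have /andP[] := Kf n x.
  have -> : \int[mu]_x (c n * f n x) = \int[nu]_x (c n * f n x).
    rewrite (RintegralZl _ measurableT (intf mu n)).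
    rewrite (RintegralZl _ measurableT (intf nu n)); congr (_ * _).
    apply/eqP; rewrite -subr_eq0 -normr_le0 -mn.
    exact: le_kantorovich.
  apply: le_Rintegral => //.
  - exact: intcf.
  - exact: integrable_indic.
  by move=> x _; have /andP[] := Kf n x.
have : mu \o K @ \oo --> mu (\bigcup_n K n).
  apply: nondecreasing_cvg_mu => //; first by rewrite KU.
  by move=> m n mlen; apply/subsetPset; exact: ndK.
rewrite KU; apply: cvge_le; exact: nearW.
Qed.

(** Measures at distance zero agree on the open sets, which are stable under intersection and
    generate the Borel sets. *)
Lemma kantorovich0P mu nu : kantorovich mu nu = 0 <-> measure_eq mu nu.
Proof.
split => [mn A mA|mn]; last first.
  apply/eqP; rewrite eq_le; apply/andP; split.
    apply: kantorovich_le => f _.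
    by rewrite (measure_eq_Rintegral f mn) subrr normr0.
  exact: le_trans (normr_ge0 _) (le_kantorovich cX mu nu (nonexpansive_cst 0)).
apply: (@measure_unique _ R (borelType X) (@open X) (fun=> setT) _ _ _ _ mu nu _ _ A mA) => //.
- by move=> B C; exact: openI.
- by move=> _; exact: openT.
- by apply/seteqP; split => // x _; exists 0%N.
- move=> U oU; apply/eqP; rewrite eq_le !kantorovich0_open_le//.
  by rewrite kantorovich_sym.
- by move=> _; rewrite [ltLHS]probability_setT ltry.
Qed.

End kantorovich_separation.

(** * Translates and the central measure *)

Section group_translates.
Context {R : realType} {G : metricGroupType R}.
Hypothesis cG : compact [set: G].
Implicit Types (mu nu rho lam : Prob G R) (g : G).

Definition translate g mu : Prob G R := push_probability (@mulgl_continuous R G g) mu.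

Lemma nonexpansive_mulgl g (f : G -> R) :
  nonexpansive f -> nonexpansive (fun x => f (g * x)%g).
Proof. by move=> nf x y; rewrite (le_trans (nf _ _))// mdist_mulgl. Qed.

Lemma Rintegral_translate g mu (f : G -> R) : nonexpansive f ->
  \int[translate g mu]_x f x = \int[mu]_x f (g * x)%g.
Proof. by move=> nf; rewrite Rintegral_push//; exact: nonexpansive_continuous. Qed.

(** Left-invariance of the metric keeps [f] nonexpansive after composition with a left translation,
    which gives one inequality; symmetry and [g^-1] give the other. *)
Lemma kantorovich_translate g mu nu :
  kantorovich (translate g mu) nu = kantorovich mu (translate g^-1%g nu).
Proof.
have le_adj h mu1 nu1 :
    kantorovich (translate h mu1) nu1 <= kantorovich mu1 (translate h^-1%g nu1).
  apply: kantorovich_le => f nf; rewrite Rintegral_translate//.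
  rewrite (_ : \int[nu1]_x f x = \int[translate h^-1%g nu1]_x f (h * x)%g).
    by apply: le_kantorovich => //; exact: nonexpansive_mulgl.
  rewrite Rintegral_translate; last exact: nonexpansive_mulgl.
  by apply: eq_Rintegral => x _; rewrite mulVKg.
apply/eqP; rewrite eq_le le_adj/= kantorovich_sym//.
by rewrite (le_trans (le_adj _ _ _))// invgK kantorovich_sym.
Qed.

Definition right_invariant rho :=
  forall a (A : set G), rho ((fun x => x * a)%g @^-1` A) = rho A.

Lemma Rintegral_right_invariant rho a (f : G -> R) : right_invariant rho ->
  continuous f -> \int[rho]_x f (x * a)%g = \int[rho]_x f x.
Proof.
move=> inv_rho cf; rewrite -(Rintegral_push (@mulgr_continuous R G a))//.
by apply: measure_eq_Rintegral => A mA; exact: inv_rho.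
Qed.

(* Averaging the translates of [mu] against [rho] gives back [rho]. The map [f]
   being nonexpansive and the metric left-invariant, [mu] can be replaced by a
   finitely supported measure with an error uniform over the translates, which
   spares the use of Fubini's theorem. *)
Lemma right_invariant_orbit rho mu nu (M : R) : right_invariant rho ->
  (forall g, kantorovich (translate g mu) nu <= M) -> kantorovich rho nu <= M.
Proof.
move=> inv_rho orbM; apply: kantorovich_le_diff => // f nf.
apply/ler_addgt0Pr => e e0.
have [n [a [B [mB sB aB]]]] := nonexpansive_discretization cG e0.
have cfa i : continuous (fun g => f (g * a i)%g).
  move=> x; apply: (@continuous_comp _ _ _ (fun x => x * a i)%g f).
    exact: mulgr_continuous.
  exact: nonexpansive_continuous.
pose F i g := fine (mu (B i)) * f (g * a i)%g.
have cF i : continuous (F i).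
  by move=> x; apply: cvgM; [exact: cvg_cst|exact: cfa].
(* By right-invariance every [g |-> f (g * a i)] has the same [rho]-integral as [f], and the weights
   [mu (B i)] add up to one. *)
have -> : \int[rho]_x f x = \int[rho]_g (\sum_i F i g).
  rewrite Rintegral_sum; last by move=> i; exact: continuous_integrable.
  rewrite -[LHS]mul1r -(sB mu) mulr_suml; apply: eq_bigr => i _.
  rewrite RintegralZl//; last exact: continuous_integrable.
  by rewrite Rintegral_right_invariant//; exact: nonexpansive_continuous.
rewrite lerBlDr; apply: Rintegral_le => //.
  by apply: continuous_big => [p|i _]; [exact: add_continuous|exact: cF].
(* For fixed [g] the finite sum approximates, within [e], the integral of [f] against the translate
   of [mu] by [g]. *)
move=> g; have := le_trans (ler_norm _)
  (le_trans (le_kantorovich cG (translate g mu) nu nf) (orbM g)).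
have := aB mu _ (nonexpansive_mulgl g nf); rewrite Rintegral_translate// ler_distlC.
under eq_bigr do rewrite mulrC.
by move=> /andP[_]; lra.
Qed.

Lemma right_invariant_centers rho : right_invariant rho ->
  chebyshev_centers_infty kantorovich [set: Prob G R] =
  [set nu | measure_eq nu rho].
Proof.
move=> inv_rho; have [D XD] := kantorovich_bounded cG.
rewrite (@chebyshev_centers_infty_orbit _ _ kantorovich D
  (kantorovichxx cG) (kantorovich_sym cG) (kantorovich_triangle cG)
  _ _ (kantorovich_midpoint cG) G translate (fun g => g^-1)%g
  kantorovich_translate rho)//.
- by apply/seteqP; split => nu /=; rewrite kantorovich0P.
- by move=> mu nu; apply: kantorovich_le => f nf; exact: XD.
- by move=> mu nu M; exact: right_invariant_orbit.
- exact: kantorovich_totally_bounded.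
Qed.

Lemma centers_translate g mu :
  chebyshev_centers_infty kantorovich [set: Prob G R] mu ->
  chebyshev_centers_infty kantorovich [set: Prob G R] (translate g mu).
Proof.
have [D XD] := kantorovich_bounded cG.
move=> Cmu n _; apply: (iter_center_isometry (kantorovichxx cG)
  (kantorovich_sym cG) (kantorovich_triangle cG) _ kantorovich_translate).
  by move=> mu1 nu1; apply: kantorovich_le => f nf; exact: XD.
exact: Cmu.
Qed.

End group_translates.

(** The left-invariant metric yields a left-invariant measure, but averaging left translates calls
    for a right-invariant one. Inversion exchanges the two and, being a homeomorphism, preserves
    regularity. *)
Lemma right_haar_exists {R : realType} {G : metricGroupType R} :
  compact [set: G] -> exists2 rho : Prob G R, right_invariant rho &
  forall (A : set G) e, 0 < e ->
    exists U, [/\ open U, A `<=` U & (rho U <= rho A + e%:E)%E].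
Proof.
move=> cG; have [lam [inv_lam reg_lam]] := left_haar_exists cG.
exists (push_probability (@invg_continuous _ G) lam).
  move=> a A.
  transitivity (lam ((fun x => a^-1 * x)%g @^-1` ((fun x => x^-1)%g @^-1` A))).
    congr (lam _).
    by apply/seteqP; split => x /=; rewrite invgM invgK.
  by rewrite -image_mulgl inv_lam.
move=> A e e0; have [V [oV AV Ve]] := reg_lam ((fun x => x^-1)%g @^-1` A) _ e0.
exists ((fun x => x^-1)%g @^-1` V); split.
- by apply: open_comp => // x _; exact: invg_continuous.
- by move=> x Ax; apply: AV; rewrite /= invgK.
- rewrite push_probabilityE; set W := _ @^-1` _; have -> : W = V; last exact: Ve.
  by apply/seteqP; split => x; rewrite /W /= invgK.
Qed.

(** Inner regularity comes from exhausting an open set by closed sets, which are compact because [X]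
    is. *)
Lemma regular_probability_radon {R : realType} {X : pmetricType R} (mu : Prob X R) :
  compact [set: X] ->
  (forall (A : set (borelType X)) e, measurable A -> 0 < e ->
    exists U : set X, [/\ open U, A `<=` U & (mu U <= mu A + e%:E)%E]) ->
  is_radon mu.
Proof.
move=> cX reg_mu; split.
- move=> K cK; rewrite (le_lt_trans (probability_le1 _ _)) ?ltry//.
  apply: closed_borel_measurable; apply: compact_closed => //.
  exact: metric_hausdorff.
- move=> A mA; apply/eqP; rewrite eq_le; apply/andP; split.
    apply: le_ereal_inf_tmp => _ [U [oU AU] <-]; apply: le_measure => //.
    + by rewrite inE.
    + by rewrite inE; exact: open_borel_measurable.
  apply/lee_addgt0Pr => e e0; have [U [oU AU Ue]] := reg_mu A e mA e0.
  by apply: le_trans Ue; apply: ereal_inf_lbound; exists U.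
- move=> U oU; apply/eqP; rewrite eq_le; apply/andP; split; last first.
    apply: ge_ereal_sup => _ [K [cK KU] <-]; apply: le_measure => //.
    + rewrite inE; apply: closed_borel_measurable; apply: compact_closed => //.
      exact: metric_hausdorff.
    + by rewrite inE; exact: open_borel_measurable.
  have [K [_ [_ [clK ndK KU _ _]]]] := open_exhaustion oU.
  have : mu \o K @ \oo --> mu (\bigcup_n K n).
    apply: nondecreasing_cvg_mu.
    + by move=> n; exact: closed_borel_measurable.
    + by rewrite KU; exact: open_borel_measurable.
    + by move=> m n mn; apply/subsetPset; exact: ndK.
  rewrite KU; apply: cvge_le; apply: nearW => n /=.
  apply: ereal_sup_ubound; exists (K n) => //; split.
    by apply: (subclosed_compact (clK n) cX).
  by rewrite -KU => x Kx; exists n.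
Qed.

Theorem corollary4p3 (R : realType) (G : metricGroupType R)
    (cG : compact [set: G]) :
  (exists mu : Prob G R, is_central_measure mu) /\
  (forall mu : Prob G R, is_central_measure mu -> is_haar mu).
Proof.
have [rho inv_rho reg_rho] := right_haar_exists cG.
have CE := right_invariant_centers cG inv_rho.
split=> [|mu]; first by exists rho.
move=> central_mu; have Cmu : chebyshev_centers_infty kantorovich [set: Prob G R] mu.
  by rewrite central_mu /=.
have mu_rho : measure_eq mu rho by move: Cmu; rewrite CE.
(* A translate of [mu] lies in every iterated center, hence agrees with [mu] on the Borel sets by
   uniqueness. *)
have translate_mu g : measure_eq (translate g mu) mu.
  by have := centers_translate cG g Cmu; rewrite central_mu.
have reg_mu (A : set (borelType G)) e : measurable A -> 0 < e ->
    exists U : set G, [/\ open U, A `<=` U & (mu U <= mu A + e%:E)%E].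
  move=> mA e0; have [U [oU AU Ue]] := reg_rho A e e0; exists U; split => //.
  by rewrite !mu_rho//; exact: open_borel_measurable.
split; first exact: regular_probability_radon.
- by rewrite [X in X != _]probability_setT.
- by move=> g A mA; rewrite image_mulgl; exact: translate_mu.
Qed.
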